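(* Let $a$ be a fixed arc, with associated finite path set $\mathcal{P}_a$, capacity-level set $\mathcal{T}_a=\{1,\dots,T_a^{\max}\}$, demands $d_p$ ($p\in\mathcal{P}_a$) and unit capacity $q_a$ as described in the context, and let $$S:= \left\{ (x, y) \in \{0,1\}^{|\mathcal{P}_a|} \times \{0,1\}^{|\mathcal{T}_a|} \ \middle|\ \sum_{p\in \mathcal{P}_a}d_px_p \leq q_a\sum_{t \in\mathcal{T}_a} t\, y_t,\ \ \sum_{t\in \mathcal{T}_a}y_t\leq 1 \right\}.$$ Then there exist (entrywise) non-negative real matrices $G$ and $H$ (with the same finite number of rows, and with $|\mathcal{P}_a|$ and $|\mathcal{T}_a|$ columns, respectively) such that $$\mathrm{conv}(S) = \left\{ (x, y) \in [0,1]^{|\mathcal{P}_a|} \times [0,1]^{|\mathcal{T}_a|} \ \middle|\ Gx \leq Hy,\ \ \sum_{t\in\mathcal{T}_a}y_t\leq 1 \right\}.$$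
   Context: Let $\mathcal{K}$ be a finite set of commodities. Each commodity $k\in\mathcal{K}$ has a demand $d_k\in\mathbb{Z}_+$ and a finite set $\mathcal{P}_k$ of paths (in a directed network) that it may use; each path belongs to a unique commodity, i.e. the sets $\mathcal{P}_k$ are pairwise disjoint. For a path $p\in\mathcal{P}_k$ write $d_p:=d_k$. Fix an arc $a$ of the network with unit capacity $q_a\in\mathbb{Z}_+$. Here $\mathbb{Z}_+$ denotes the positive integers. Set $\mathcal{P}_a=\{p\in\bigcup_{k\in\mathcal{K}}\mathcal{P}_k : p \text{ contains } a\}$. Let $\delta_a^k=1$ if some path in $\mathcal{P}_k$ contains $a$ and $\delta_a^k=0$ otherwise, and let $T_a^{\max}=\left\lceil \frac{\sum_{k\in\mathcal{K}}\delta_a^k d_k}{q_a}\right\rceil$ and $\mathcal{T}_a=\{1,\dots,T_a^{\max}\}$. Vectors $x$ are indexed by $\mathcal{P}_a$ and vectors $y$ by $\mathcal{T}_a$. $\mathrm{conv}$ denotes the convex hull. *)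

(* Defs.v *)
From HB Require Import structures.
From mathcomp Require Import all_boot all_order all_algebra finmap.
From mathcomp Require Import classical_sets reals convex.

Set Implicit Arguments.
Unset Strict Implicit.
Unset Printing Implicit Defensive.

Import Order.TTheory GRing.Theory Num.Theory.

Local Open Scope ring_scope.

Record network := Network {
  net_node : choiceType;
  net_arc : choiceType;
  net_tail : net_arc -> net_node;
  net_head : net_arc -> net_node
}.

(* A path is the sequence of its arcs; repeated vertices are not excluded. *)
Definition is_dipath (N : network) (p : seq (net_arc N)) : bool :=
  sorted (fun e f => net_head e == net_tail f) p.

Section ArcSet.
Variables (N : network) (K : finType).
Variables (d : K -> nat) (P : K -> {fset seq (net_arc N)}).
Variables (a : net_arc N) (q : nat).

Definition arc_paths : {fset seq (net_arc N)} :=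
  [fset p in (\bigcup_(k in K) P k)%fset | a \in p]%fset.

(* The default 0 only concerns sequences lying in no [P k]; when the [P k] are
   pairwise disjoint, the commodity picked is the only possible one. *)
Definition path_demand (p : seq (net_arc N)) : nat :=
  if [pick k | p \in P k] is Some k then d k else 0%N.

Definition arc_used (k : K) : bool := has (fun p => a \in p) (P k).

Definition Tmax : nat :=
  `|Num.ceil ((\sum_(k : K) arc_used k * d k)%N%:R / q%:R : rat)|%N.

Definition npaths : nat := #|{: arc_paths}|.

(* Coordinate [i] of [x] belongs to the path [enum_val i]; coordinate
   [t : 'I_Tmax] of [y] belongs to the capacity level [t.+1]. *)
Definition capacity_set (R : realType) : set ('cV[R]_npaths * 'cV[R]_Tmax) :=
  [set z : 'cV[R]_npaths * 'cV[R]_Tmax |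
    [/\ forall i, z.1 i 0 = 0 \/ z.1 i 0 = 1,
        forall t, z.2 t 0 = 0 \/ z.2 t 0 = 1,
        \sum_(i < npaths) (path_demand (val (enum_val i)))%:R * z.1 i 0
          <= q%:R * \sum_(t < Tmax) t.+1%:R * z.2 t 0
      & \sum_(t < Tmax) z.2 t 0 <= 1]]%classic.

End ArcSet.

Arguments capacity_set {N K} d P a q R.

Definition convex_hull (R : realType) (M : lmodType R) (A : set M) : set M :=
  smallest (@convex_set R M) A.

(* Main.v *)
Require Import Defs.
From HB Require Import structures.
From mathcomp Require Import all_boot all_order all_algebra finmap.
From mathcomp Require Import classical_sets reals convex.
From mathcomp Require Import interval_inference ring lra.

(** The points of the capacity set are the origin and the pairs
    [(1_A, e_t)], where [A] is a set of paths whose total demand fits into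
    [t + 1] capacity units: positivity of the demands rules out every nonzero
    [x] when [y = 0].  So the convex hull is a cone with apex at the
    origin, truncated by [\sum_t y_t <= 1].  For each level
    [t], moreover, the admissible [A] are closed under taking subsets and
    include the empty set; [hull_level_set] treats this general situation.

    Let [C] be the cone generated by the vectors [(1_A, e_t)] together with
    the directions [(- e_i, 0)].  By Weyl's theorem ([weyl], obtained by
    adding generators one at a time and eliminating their multipliers by
    Fourier-Motzkin), [C] is cut out by finitely many inequalities
    [g x <= h y].  Evaluating such an inequality at the generators
    [(- e_i, 0)] and [(0, e_t)] of [C] gives [g >= 0] and [h >= 0]; the rows
    [g] and [h] form [G] and [H].

    The right-hand side is convex and contains the vertices, hence the hull.
    Conversely, a point [(x, y)] of [C] satisfies [x <= x'] for some
    [(x', y)] which equals [\sum_t y_t] times a point of the hull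
    ([in_cone_hull]); when [\sum_t y_t <= 1], averaging with the origin puts
    [(x', y)] in the hull.  Since [0 <= x <= x'], the hull contains
    [(x, y)] as well ([hull_down]). *)

Set Implicit Arguments.
Unset Strict Implicit.
Unset Printing Implicit Defensive.

Import Order.TTheory GRing.Theory Num.Theory.

Local Open Scope ring_scope.

(** * Finitely generated cones are polyhedral *)

Section FourierMotzkin.
Variables (F : realFieldType) (n : nat).
Implicit Types (a b : 'rV[F]_n) (w z : 'cV[F]_n).

Definition dot a z : F := (a *m z) 0 0.

Lemma dotD a z z' : dot a (z + z') = dot a z + dot a z'.
Proof. by rewrite /dot mulmxDr mxE. Qed.

Lemma dotZ a c z : dot a (c *: z) = c * dot a z.
Proof. by rewrite /dot -scalemxAr mxE. Qed.

Lemma dotBl a b z : dot (a - b) z = dot a z - dot b z.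
Proof. by rewrite /dot mulmxBl !mxE. Qed.

Lemma dotZl a c z : dot (c *: a) z = c * dot a z.
Proof. by rewrite /dot -scalemxAl mxE. Qed.

Lemma dotBZ a z c w : dot a (z - c *: w) = dot a z - c * dot a w.
Proof. by rewrite -scaleNr dotD dotZ mulNr. Qed.

(** Each [a] in [A] bounds [mu] below if [dot a w > 0], above if
    [dot a w < 0], and not at all if [dot a w = 0].  A common solution
    [mu >= 0] exists iff every lower bound, including 0, is at most every
    upper bound; cleared of denominators, these comparisons are again
    homogeneous linear inequalities in [z]. *)
Lemma fourier_motzkin (A : seq 'rV[F]_n) w :
  exists B : seq 'rV[F]_n, forall z,
    (exists2 mu, 0 <= mu & {in A, forall a, dot a (z - mu *: w) <= 0})
      <-> {in B, forall b, dot b z <= 0}.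
Proof.
exists ([seq a <- A | dot a w <= 0] ++
  [seq dot a w *: b - dot b w *: a |
    a <- [seq a <- A | 0 < dot a w], b <- [seq b <- A | dot b w < 0]]) => z.
split=> [[mu mu0 le0] c|le0].
  rewrite mem_cat => /orP[|].
    rewrite mem_filter => /andP[aw0 /le0]; rewrite dotBZ.
    by have := mulr_ge0_le0 mu0 aw0; lra.
  case/allpairsP=> -[a b] [] /=; rewrite !mem_filter.
  move=> /andP[aw0 /le0 az] /andP[bw0 /le0 bz] ->.
  by rewrite !dotBZ in az bz; rewrite dotBl !dotZl; nra.
(* The smallest candidate: the greatest of all the lower bounds. *)
pose mu := \big[Order.max/0]_(a <- A | 0 < dot a w) (dot a z / dot a w).
have mu0 : 0 <= mu by apply: bigmax_ge_id.
exists mu => // a aA; rewrite dotBZ subr_le0.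
have [aw0|aw0|aw0] := ltgtP (dot a w) 0.
- rewrite -ler_ndivlMr // /mu big_seq_cond; apply: bigmax_le.
    rewrite -mulrNN mulr_ge0 // oppr_ge0 ?invr_le0 ?(ltW aw0) //.
    by apply: le0; rewrite mem_cat mem_filter aA (ltW aw0).
  move=> b /andP[bA bw0]; rewrite ler_ndivlMr // mulrAC ler_pdivlMr //.
  have : dot (dot b w *: a - dot a w *: b) z <= 0.
    apply: le0; rewrite mem_cat; apply/orP; right; apply/allpairsP.
    by exists (b, a); rewrite /= !mem_filter aA bA aw0 bw0.
  by rewrite dotBl !dotZl; lra.
- rewrite -ler_pdivrMr // /mu.
  by apply: (le_bigmax_seq 0 a (fun a => 0 < dot a w)
    (fun a => dot a z / dot a w)).
- rewrite aw0 mulr0; apply: le0.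
  by rewrite mem_cat mem_filter aA aw0 lexx.
Qed.

(** Recursion on the list exposes one multiplier at a time, which is the form
    in which Fourier-Motzkin eliminates them. *)
Fixpoint in_cone (s : seq 'cV[F]_n) z : Prop :=
  if s is w :: s' then exists2 mu, 0 <= mu & in_cone s' (z - mu *: w)
  else z = 0.

Lemma in_cone0 s : in_cone s 0.
Proof.
by elim: s => //= w s IH; exists 0 => //; rewrite scale0r subr0.
Qed.

Lemma mem_in_cone s w : w \in s -> in_cone s w.
Proof.
elim: s => //= v s IH; rewrite inE => /predU1P[->|/IH ws].
  by exists 1 => //; rewrite scale1r subrr; apply: in_cone0.
by exists 0 => //; rewrite scale0r subr0.
Qed.

(** Weyl's theorem.  The cone on no generators is the origin, cut out by the
    inequalities [z_i <= 0] and [- z_i <= 0]; each further generator brings in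
    one multiplier, which is then eliminated. *)
Theorem weyl s :
  exists B : seq 'rV[F]_n, forall z,
    in_cone s z <-> {in B, forall b, dot b z <= 0}.
Proof.
elim: s => [|w s [A coneA]].
  exists ([seq delta_mx 0 i | i : 'I_n] ++ [seq - delta_mx 0 i | i : 'I_n]).
  move=> z /=; split=> [->|le0].
    by move=> b _; rewrite /dot mulmx0 mxE.
  apply/colP=> i; rewrite mxE; apply/eqP; rewrite eq_le.
  have dotE : dot (delta_mx 0 i) z = z i 0 by rewrite /dot -rowE mxE.
  apply/andP; split.
    by rewrite -dotE; apply: le0; rewrite mem_cat fintype.image_f.
  rewrite -oppr_le0 -dotE -[X in X <= _]mulN1r -dotZl scaleN1r.
  apply: le0; rewrite mem_cat orbC.
  by rewrite (fintype.image_f (fun i => - delta_mx 0 i)).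
have [B elimB] := fourier_motzkin A w.
exists B => z; rewrite -elimB /=.
by split=> -[mu mu0 /coneA cz]; exists mu.
Qed.

End FourierMotzkin.

(** * Convex hulls in a module *)

Section ConvexHull.
Variables (R : realType) (M : lmodType R).
Implicit Types (A : set M) (u v : M).

(** The same notion with a bounded scalar instead of an element of the type of
    the unit interval, so that membership goals stay free of coercions. *)
Lemma convex_setP A :
  convex_set A <->
  forall u v (c : R), A u -> A v -> 0 <= c <= 1 -> A (c *: u + (1 - c) *: v).
Proof.
split=> [cA u v c Au Av /andP[c0 c1]|cA u v c].
  have := cA u v (@Itv01 R c c0 c1); rewrite !inE; apply.
    exact: Au.
  exact: Av.
rewrite !inE => Au Av; apply: (cA u v) => //.
by rewrite ge0 le1.
Qed.

Lemma convex_hull_convex A u v (c : R) :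
  convex_hull A u -> convex_hull A v -> 0 <= c <= 1 ->
  convex_hull A (c *: u + (1 - c) *: v).
Proof.
move=> Au Av c01 B cAB; have [cB _] := cAB.
by move/convex_setP: cB; apply; [apply: Au | apply: Av |].
Qed.

(** Nonnegative multiples of points of a convex set are closed under addition;
    keeping the total weight [b + c] explicit is what lets [in_cone_hull] track
    it. *)
Lemma convex_hull_cone A u v (b c : R) :
  convex_hull A u -> convex_hull A v -> 0 <= b -> 0 <= c ->
  exists2 w, convex_hull A w & b *: u + c *: v = (b + c) *: w.
Proof.
move=> Au Av b0 c0; have [bc0|bc0] := eqVneq (b + c) 0.
  have -> : b = 0 by lra.
  have -> : c = 0 by lra.
  by exists u; rewrite ?addr0 // !scale0r addr0.
exists (b / (b + c) *: u + (1 - b / (b + c)) *: v).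
  apply: convex_hull_convex => //.
  by rewrite divr_ge0 ?addr_ge0 //= ler_pdivrMr ?mul1r ?lerDl //; lra.
rewrite scalerDr !scalerA; congr (_ *: _ + _ *: _).
  by rewrite mulrC divfK.
by rewrite mulrBr mulr1 mulrC divfK // addrAC subrr add0r.
Qed.

End ConvexHull.

(** * Hulls of level-indexed independence systems *)

Section LevelSet.
Variables (R : realType) (n T : nat) (F : 'I_T -> {set {set 'I_n}}).
Hypothesis F0 : forall t, finset.set0 \in F t.
Hypothesis F_down : forall t (A B : {set 'I_n}),
  A \subset B -> B \in F t -> A \in F t.

Local Notation X := 'cV[R]_n.
Local Notation Y := 'cV[R]_T.

Definition indicator (A : {set 'I_n}) : X := \col_i (i \in A)%:R.

Definition level_set : set (X * Y) :=
  [set z | z = 0 \/ exists t, exists2 A, A \in F t &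
                    z = (indicator A, delta_mx t 0)]%classic.

Local Notation hull := (convex_hull level_set).

Lemma hull_level z : level_set z -> hull z.
Proof. exact: sub_gen_smallest. Qed.

Definition scale_coord (i : 'I_n) (c : R) (x : X) : X :=
  \col_j (if j == i then c * x j 0 else x j 0).

(** Scaling a coordinate is linear, so it suffices to treat the vertices.
    There, scaling coordinate [i] of [1_A] by [c] gives the average of [1_A] and
    of the indicator of [A :\ i] with weights [c] and [1 - c]. *)
Lemma hull_scale_coord i c z :
  0 <= c <= 1 -> hull z -> hull (scale_coord i c z.1, z.2).
Proof.
move=> c01; pose S := [set z | hull (scale_coord i c z.1, z.2)]%classic.
apply: (@smallest_sub _ _ _ S).
  apply/convex_setP => u v b; rewrite /S /= => hu hv b01.
  rewrite (_ : (_, _) = b *: (scale_coord i c u.1, u.2)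
                        + (1 - b) *: (scale_coord i c v.1, v.2)).
    exact: convex_hull_convex.
  congr (_, _); apply/colP => j; rewrite !mxE; case: ifP => // _; ring.
move=> _ [->|[t [A AF ->]]]; rewrite /S /=.
  rewrite (_ : (_, _) = 0); first by apply: hull_level; left.
  by congr (_, _); apply/colP => j; rewrite !mxE mulr0 if_same.
rewrite (_ : (_, _) = c *: (indicator A, delta_mx t 0)
                      + (1 - c) *: (indicator (A :\ i), delta_mx t 0)).
  apply: convex_hull_convex => //; apply: hull_level; right; exists t.
    by exists A.
  by exists (A :\ i) => //; apply: F_down AF; apply: finset.subsetDl.
congr (_, _); apply/colP => j; rewrite !mxE ?in_setD1; last by ring.
by case: eqP => _ /=; ring.
Qed.

(** Coordinates of [x'] are lowered to those of [x] one at a time, each by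
    multiplication by the ratio [x_i / x'_i]. *)
Lemma hull_down (x x' : X) (y : Y) :
  (forall i, 0 <= x i 0 <= x' i 0) -> hull (x', y) -> hull (x, y).
Proof.
move=> xx' hx'.
suff H (s : seq 'I_n) : hull (\col_i (if i \in s then x i 0 else x' i 0), y).
  have := H (enum 'I_n); congr (hull (_, _)); apply/colP => i.
  by rewrite mxE mem_enum.
elim: s => [|i s IH].
  by move: hx'; congr (hull (_, _)); apply/colP => i; rewrite mxE.
have [is_|is_] := boolP (i \in s).
  move: IH; congr (hull (_, _)); apply/colP => j; rewrite !mxE inE.
  by case: eqP => [->|]; rewrite ?is_.
have /andP[x0 xle] := xx' i.
have c01 : 0 <= x i 0 / x' i 0 <= 1.
  rewrite divr_ge0 //=; last exact: le_trans xle.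
  have [->|x'0] := eqVneq (x' i 0) 0; first by rewrite invr0 mulr0.
  by rewrite ler_pdivrMr ?mul1r // lt_neqAle eq_sym x'0 (le_trans x0).
(* If [x'_i = 0], then [x_i = 0] and the ratio is 0 by convention. *)
have := hull_scale_coord i c01 IH; congr (hull (_, _)).
apply/colP => j; rewrite !mxE inE; case: eqP => //= ->.
rewrite (negPf is_); have [x'0|x'0] := eqVneq (x' i 0) 0.
  by rewrite x'0 mulr0; lra.
by rewrite divfK.
Qed.

(** The directions [(- e_i, 0)] make the cone closed under decreasing [x];
    they are responsible for the nonnegativity of [G]. *)
Definition generators : seq 'cV[R]_(n + T) :=
  [seq - col_mx (delta_mx i 0) 0 | i <- enum 'I_n] ++
  [seq col_mx (indicator p.2) (delta_mx p.1 0)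
     | p <- enum {: 'I_T * {set 'I_n}} & p.2 \in F p.1].

Lemma neg_generator i : - col_mx (delta_mx i 0) 0 \in generators.
Proof.
rewrite mem_cat; apply/orP; left; apply/mapP; exists i => //.
by rewrite mem_enum.
Qed.

Lemma level_generator t A :
  A \in F t -> col_mx (indicator A) (delta_mx t 0) \in generators.
Proof.
move=> AF; rewrite mem_cat; apply/orP; right; apply/mapP; exists (t, A) => //.
by rewrite mem_filter AF mem_enum.
Qed.

(** Generators [(- e_i, 0)] only lower [x], and are absorbed by the slack
    between [x] and [x'].  Every generator [(1_A, e_t)] contributes exactly its
    multiplier to [\sum_t y_t], so this sum is the total weight of the conic
    combination of hull points. *)
Lemma in_cone_hull (s : seq 'cV[R]_(n + T)) (x : X) (y : Y) :
  {subset s <= generators} -> in_cone s (col_mx x y) ->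
  exists2 x' : X, forall i, x i 0 <= x' i 0 &
    0 <= \sum_t y t 0 /\
    exists2 v, hull v & (x', y) = (\sum_t y t 0) *: v.
Proof.
elim: s x y => [|w s IH] x y sub /=.
  rewrite -col_mx0 => /eq_col_mx[-> ->]; exists 0 => //; split.
    by rewrite big1 // => t _; rewrite mxE.
  by exists 0; [apply: hull_level; left | rewrite scaler0].
case=> mu mu0.
have /IH{}IH : {subset s <= generators}.
  by move=> v vs; apply: sub; rewrite inE vs orbT.
have : w \in generators by apply: sub; rewrite mem_head.
rewrite mem_cat => /orP[/mapP[i _ ->]|/mapP[[t A]]].
  rewrite scalerN opprK scale_col_mx add_col_mx scaler0 addr0.
  case/IH => x' xx' H; exists x' => // j; apply: le_trans (xx' j).
  by rewrite !mxE lerDl mulr_ge0 // ler0n.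
rewrite mem_filter => /andP[/= AF _ ->].
rewrite scale_col_mx opp_col_mx add_col_mx => /IH [x' xx' [sy0 [v hv yv]]].
set y1 := y - mu *: delta_mx t 0 in sy0 yv *.
have sy : \sum_r y r 0 = \sum_r y1 r 0 + mu.
  have -> : mu = \sum_r (mu *: delta_mx t 0 : Y) r 0.
    rewrite (bigD1 t) //= big1 ?addr0 => [|r /negPf rt].
      by rewrite !mxE !eqxx mulr1.
    by rewrite !mxE rt mulr0.
  by rewrite -big_split; apply: eq_bigr => r _; rewrite /y1 !mxE /=; ring.
exists (x' + mu *: indicator A).
  by move=> j; have := xx' j; rewrite !mxE; lra.
rewrite sy; split; first exact: addr_ge0.
have hA : hull (indicator A, delta_mx t 0).
  by apply: hull_level; right; exists t, A.
have [u hu uE] := convex_hull_cone hv hA sy0 mu0.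
exists u => //; rewrite -uE -yv; congr (_, _).
by rewrite /y1 subrK.
Qed.

(** The hypothesis that each [F t] contains the empty set, through the vertices
    [(0, e_t)], yields the nonnegativity of [H]; closure under subsets lets the
    box constraint [0 <= x] suffice to descend from the cone to the hull. *)
Theorem hull_level_set :
  exists (m : nat) (G : 'M[R]_(m, n)) (H : 'M[R]_(m, T)),
    [/\ forall i j, 0 <= G i j,
        forall i j, 0 <= H i j
      & hull =
        [set z : X * Y |
          [/\ forall j, 0 <= z.1 j 0 <= 1,
              forall t, 0 <= z.2 t 0 <= 1,
              forall i, (G *m z.1) i 0 <= (H *m z.2) i 0
            & \sum_(t < T) z.2 t 0 <= 1]]%classic].
Proof.
have [B coneB] := weyl generators.
pose C : 'M[R]_(size B, n + T) := \matrix_(i < size B) tnth (in_tuple B) i.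
pose G := lsubmx C; pose H := - rsubmx C.
have inB i : row i C \in B by rewrite rowK mem_tnth.
have dotC i (x : X) (y : Y) :
    dot (row i C) (col_mx x y) = (G *m x) i 0 - (H *m y) i 0.
  rewrite /dot -row_mul mxE -[C in LHS]hsubmxK mul_row_col mxE.
  by rewrite mulNmx [X in _ = _ - X]mxE opprK.
have coneGH (x : X) (y : Y) : in_cone generators (col_mx x y) <->
    forall i, (G *m x) i 0 <= (H *m y) i 0.
  rewrite coneB; split=> [le0 i|le b /(tnthP (in_tuple B))[i ->]].
    by rewrite -subr_le0 -dotC le0.
  by rewrite -[tnth _ _](rowK (fun i => tnth (in_tuple B) i)) dotC subr_le0.
exists (size B), G, H; split=> [i j|i j|].
(* Row [i] is nonpositive on the cone, in particular at [(- e_j, 0)]. *)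
- have := (coneB _).1 (mem_in_cone (neg_generator j)) _ (inB i).
  rewrite -[col_mx _ _]opprK opprK -scaleN1r dotZ dotC mulmx0 [X in _ - X]mxE.
  by rewrite subr0 -colE mxE mulN1r oppr_le0.
(* Likewise at [(0, e_j)]. *)
- have := (coneGH _ _).1 (mem_in_cone (level_generator (F0 j))) i.
  rewrite -colE [X in _ <= X]mxE; apply: le_trans.
  rewrite (_ : indicator finset.set0 = 0) ?mulmx0 ?mxE //.
  by apply/colP => k; rewrite !mxE finset.in_set0.
apply/seteqP; split=> [|[x y] [/= x01 y01 xy sy]].
  apply: smallest_sub.
    apply/convex_setP => -[ux uy] [vx vy] c /=.
    move=> [ux01 uy01 uxy su] [vx01 vy01 vxy sv] /andP[c0 c1].
    have c1' : 0 <= 1 - c by lra.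
    split=> [j|t|i|].
    + by have := ux01 j; have := vx01 j; rewrite !mxE; nra.
    + by have := uy01 t; have := vy01 t; rewrite !mxE; nra.
    + rewrite !mulmxDr -!scalemxAr !mxE.
      have := uxy i; have := vxy i; rewrite !mxE => vxyi uxyi.
      by apply: lerD; apply: ler_wpM2l.
    + under eq_bigr do rewrite !mxE.
      by rewrite big_split /= -!mulr_sumr; nra.
  move=> _ [->|[t [A AF ->]]]; split=> /=.
  + by move=> j; rewrite mxE lexx ler01.
  + by move=> t; rewrite mxE lexx ler01.
  + by move=> i; rewrite !mulmx0.
  + by rewrite big1 // => t _; rewrite mxE.
  + by move=> j; rewrite mxE ler0n lern1 leq_b1.
  + by move=> s; rewrite mxE ler0n lern1 leq_b1.
  + by apply/coneGH/mem_in_cone/level_generator.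
  + rewrite (bigD1 t) //= big1 ?addr0 => [|r /negPf rt].
      by rewrite mxE !eqxx.
    by rewrite mxE rt.
have /coneGH c := xy.
have [x' xx' [s0 [v hv x'y]]] := in_cone_hull (fun _ => id) c.
apply: (@hull_down x x').
  by move=> i; rewrite xx'; case/andP: (x01 i) => ->.
(* The missing weight [1 - \sum_t y_t] goes to the origin. *)
rewrite x'y -[_ *: v]addr0 -[X in _ + X](scaler0 _ (1 - \sum_t y t 0)).
apply: convex_hull_convex => //; first by apply: hull_level; left.
by rewrite s0.
Qed.

End LevelSet.

(** * The capacity set of an arc *)

Theorem proposition1 (R : realType) (N : network) (K : finType)
    (d : K -> nat) (P : K -> {fset seq (net_arc N)}) (a : net_arc N) (q : nat)
    (d_gt0 : forall k, (0 < d k)%N)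
    (P_path : forall k p, p \in P k -> is_dipath p)
    (P_disj : forall k l, k != l -> [disjoint P k & P l]%fset)
    (q_gt0 : (0 < q)%N) :
  exists (m : nat) (G : 'M[R]_(m, npaths P a)) (H : 'M[R]_(m, Tmax d P a q)),
    [/\ forall i j, 0 <= G i j,
        forall i j, 0 <= H i j
      & convex_hull (capacity_set d P a q R) =
        [set z : 'cV[R]_(npaths P a) * 'cV[R]_(Tmax d P a q) |
          [/\ forall j, 0 <= z.1 j 0 <= 1,
              forall t, 0 <= z.2 t 0 <= 1,
              forall i, (G *m z.1) i 0 <= (H *m z.2) i 0
            & \sum_(t < Tmax d P a q) z.2 t 0 <= 1]]%classic].
Proof.
pose D (i : 'I_(npaths P a)) := path_demand d P (val (enum_val i)).
have D_gt0 i : (0 < D i)%N.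
  have := valP (enum_val i); rewrite /D /path_demand.
  case: pickP => [k _ _|noP]; first exact: d_gt0.
  rewrite !inE => /andP[/bigfcupP[k _ pk] _].
  by have := noP k; rewrite pk.
pose F (t : 'I_(Tmax d P a q)) :=
  [set A : {set 'I_(npaths P a)} | (\sum_(i in A) D i <= q * t.+1)%N].
have F0 t : finset.set0 \in F t by rewrite inE finset.big_set0.
have F_down t (A B : {set 'I_(npaths P a)}) :
    A \subset B -> B \in F t -> A \in F t.
  rewrite !inE => AB; apply: leq_trans.
  by rewrite [leqRHS](big_setID A) /= (finset.setIidPr AB) leq_addr.
suff -> : capacity_set d P a q R = level_set F by apply: hull_level_set.
have demandE (A : {set 'I_(npaths P a)}) :
    \sum_i (D i)%:R * (@indicator R _ A) i 0 = (\sum_(i in A) D i)%:R.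
  rewrite natr_sum [RHS]big_mkcond; apply: eq_bigr => i _.
  by rewrite mxE; case: ifP; rewrite ?mulr1 ?mulr0.
have binE m (x : 'cV[R]_m) : (forall i, x i 0 = 0 \/ x i 0 = 1) ->
    x = @indicator R _ [set i | x i 0 == 1].
  move=> x01; apply/colP => i; rewrite mxE inE.
  by case: (x01 i) => ->; rewrite ?eqxx // eq_sym oner_eq0.
have sum_delta m (f : 'I_m -> R) t :
    \sum_r f r * (delta_mx t 0 : 'cV[R]_m) r 0 = f t.
  rewrite (bigD1 t) //= big1 ?addr0 => [|r /negPf rt].
    by rewrite mxE !eqxx mulr1.
  by rewrite mxE rt mulr0.
apply/seteqP; split=> [[x y] [/= x01 y01 cap sy]|_ [->|[t [A AF ->]]]].
(* A feasible point is the origin if [y = 0], by positivity of demands;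
   otherwise exactly one level is selected. *)
- rewrite (binE _ _ x01) in cap *; set A := [set i | _] in cap *.
  rewrite demandE in cap.
  have [y0|/forallPn[t yt]] := altP (@forallP _ (fun t => y t 0 == 0)).
    left; have {}y0 : y = 0 by apply/colP => t; rewrite mxE; apply/eqP.
    rewrite y0 in cap *; congr (_, _); apply/colP => i; rewrite !mxE.
    move: cap; rewrite [X in _ * X]big1 ?mulr0 => [|t _]; last first.
      by rewrite mxE mulr0.
    rewrite lern0 sum_nat_eq0 => /forallP /(_ i).
    by case: (i \in A) => //=; rewrite -leqn0 leqNgt D_gt0.
  right; exists t.
  have yt1 : y t 0 = 1 by case: (y01 t) yt => ->; rewrite ?eqxx.
  have yE : y = delta_mx t 0.
    apply/colP => r; rewrite mxE eqxx andbT.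
    have [->//|rt] := eqVneq r t.
    case: (y01 r) => // yr1.
    have : 2 <= \sum_t y t 0.
      rewrite (bigD1 t) //= (bigD1 r) //= yt1 yr1 addrA lerDl.
      by apply: sumr_ge0 => s _; case: (y01 s) => ->.
    lra.
  exists A; last by rewrite yE.
  by rewrite inE -(ler_nat R) natrM; move: cap; rewrite yE sum_delta.
- split=> /= [i|t||].
  + by left; rewrite mxE.
  + by left; rewrite mxE.
  + by rewrite !big1 ?mulr0 // => i _; rewrite mxE mulr0.
  + by rewrite big1 // => t _; rewrite mxE.
- split=> /= [i|r||].
  + by rewrite mxE; case: (_ \in _); [right | left].
  + by rewrite mxE; case: (_ && _); [right | left].
  + by rewrite demandE sum_delta -natrM ler_nat; rewrite inE in AF.
  + under eq_bigr do rewrite -[delta_mx _ _ _ _]mul1r.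
    by rewrite (sum_delta _ (fun=> 1)).
Qed.
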